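(* Let $(W,S)$ be a right-angled Coxeter system of type $\Gamma$. The restriction to $D(\Gamma)$ of the homomorphism $\rho_3:K(\Gamma)\to\prod_{T\in\mathcal C}\mathrm{Aut}(V_T)$ is bijective (onto $\prod_{T\in\mathcal C}\mathrm{Aut}(V_T)$). In particular one has the (internal) semidirect product decomposition $K(\Gamma)=K^\circ(\Gamma)\rtimes D(\Gamma)$.
   Context: $(W,S)$ is a right-angled Coxeter system (arbitrary rank): $W$ is generated by the set $S$ of elements of order $2$, with $m_{s,t}\in\{1,2,\infty\}$ the order of $st$, and $W=\langle S\mid (st)^{m_{s,t}}=1,\ m_{s,t}\ne\infty\rangle$; $\Gamma=(m_{s,t})_{s,t\in S}$. For $X\subseteq S$, $C(X)=\{y\in S\mid\forall x\in X,\ xy=yx\}$, $C^2=C\circ C$, $C^2(s)=C^2(\{s\})$. $\mathcal C=\{C^2(s)\mid s\in S\}$ is the set of cells. Kernels are the equivalence classes on $S$ for $C^2(s)=C^2(t)$; $\mathcal N$ is the set of kernels (a partition of $S$). For a cell $T$, $T^\star=\{x\in S\mid C^2(x)\subsetneq T\}$, i.e. $T$ minus the kernel $\{x\in S\mid C^2(x)=T\}$. $[S]$ is the $\mathbb F_2$-vector space of finite subsets of $S$ (addition $+$ is symmetric difference), $[T]$ the subspace of finite subsets of $T\subseteq S$; $[S]_c$ is the set of finite subsets of $S$ with pairwise commuting elements. For a cell $T$, $V_T=[T]/[T^\star]$ (quotient vector space). $\mathrm{Aut}([S])$ is the group of linear automorphisms of $[S]$ and $\mathrm{Aut}([S],[S]_c)$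 its subgroup of $\varphi$ with $\varphi([S]_c)=[S]_c$. $K(\Gamma)$ is the group of $\varphi\in\mathrm{Aut}([S],[S]_c)$ with $\varphi([T])=[T]$ for every cell $T$. Each $\varphi\in K(\Gamma)$ satisfies $\varphi([T^\star])=[T^\star]$ and so induces an automorphism $\bar\varphi_T$ of $V_T$, $X+[T^\star]\mapsto\varphi(X)+[T^\star]$; $\rho_3:\varphi\mapsto(\bar\varphi_T)_{T\in\mathcal C}$ is a group homomorphism, and $K^\circ(\Gamma)=\ker\rho_3=\{\varphi\in K(\Gamma)\mid\forall s\in S,\ \varphi(\{s\})\in\{s\}+[(C^2(s))^\star]\}$. $D(\Gamma)=\{\varphi\in\mathrm{Aut}([S])\mid\forall N\in\mathcal N,\ \varphi([N])=[N]\}$, which is a subgroup of $K(\Gamma)$. In $A\rtimes B$, $A$ is the normal factor. *)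

(* Defs.v *)
From HB Require Import structures.
From mathcomp Require Import all_boot all_algebra finmap all_classical.
From mathcomp Require Import ring_quotient.

Set Implicit Arguments.
Unset Strict Implicit.
Unset Printing Implicit Defensive.

Import GRing.Theory.
Local Open Scope classical_set_scope.
Local Open Scope ring_scope.

Section Presentation.
Local Open Scope group_scope.
Variables (X : Type) (rel : set (seq (X * bool))).

(* A letter [(x, false)] stands for [x] and [(x, true)] for its inverse, so
   that [pres_eq] identifies two words iff they have the same class in the
   quotient of the free group on [X] by the normal closure of [rel]. *)
Inductive pres_eq : seq (X * bool) -> seq (X * bool) -> Prop :=
| pres_refl u : pres_eq u u
| pres_sym u v : pres_eq u v -> pres_eq v u
| pres_trans u v w : pres_eq u v -> pres_eq v w -> pres_eq u w
| pres_cat a b u v : pres_eq u v -> pres_eq (a ++ u ++ b) (a ++ v ++ b)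
| pres_cancel x b : pres_eq [:: (x, b); (x, ~~ b)] [::]
| pres_rel r : rel r -> pres_eq r [::].

Definition word_eval (G : groupType) (f : X -> G) (w : seq (X * bool)) : G :=
  \prod_(a <- w) (if a.2 then (f a.1)^-1 else f a.1).

Definition is_presentation (G : groupType) (f : X -> G) : Prop :=
  (forall g : G, exists w, word_eval f w = g) /\
  (forall u v, word_eval f u = word_eval f v <-> pres_eq u v).

End Presentation.

Section Coxeter.
Local Open Scope group_scope.

(* [None] is the infinite order. *)
Definition has_order (G : groupType) (x : G) (o : option nat) : Prop :=
  if o is Some n then
    [/\ (0 < n)%N, x ^+ n = 1 & forall k, (0 < k < n)%N -> x ^+ k <> 1]
  else forall k, (0 < k)%N -> x ^+ k <> 1.

Definition coxeter_relators (X : Type) (m : X -> X -> option nat) :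
    set (seq (X * bool)) :=
  [set r | exists s t n, m s t = Some n /\
     r = flatten (nseq n [:: (s, false); (t, false)])].

Definition right_angled_coxeter_system (W : groupType) (S : set W)
    (Gamma : S -> S -> option nat) : Prop :=
  [/\ forall s : S, has_order (val s) (Some 2%N),
      forall s t : S, has_order (val s * val t) (Gamma s t),
      forall s t : S, Gamma s t \in [:: Some 1%N; Some 2%N; None]
    & is_presentation (coxeter_relators Gamma) (fun s : S => val s)].

End Coxeter.

Section LinearAut.
Variables (R : pzRingType) (V : lmodType R).

Record linaut := LinAut {
  linaut_fun :> V -> V;
  linaut_linear : linear linaut_fun;
  linaut_bij : bijective linaut_fun }.

HB.instance Definition _ := gen_eqMixin linaut.
HB.instance Definition _ := gen_choiceMixin linaut.
HB.instance Definition _ (f : linaut) :=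
  GRing.isLinear.Build R V V *:%R (linaut_fun f) (linaut_linear f).

Lemma linaut_eq (f g : linaut) : f =1 g -> f = g.
Proof.
case: f g => [f lf bf] [g lg bg] /= /funext fg; subst g.
by congr LinAut; exact: Prop_irrelevance.
Qed.

Lemma linaut_one_linear : linear (@id V). Proof. by []. Qed.
Definition linaut_one := LinAut linaut_one_linear (inv_bij (fun x => erefl)).

Lemma linaut_mul_linear (f g : linaut) : linear (f \o g).
Proof. by move=> a x y /=; rewrite !linearP. Qed.
Definition linaut_mul (f g : linaut) :=
  LinAut (linaut_mul_linear f g) (bij_comp (linaut_bij f) (linaut_bij g)).

Lemma linaut_inv_subproof (f : linaut) :
  exists g : linaut, cancel f g /\ cancel g f.
Proof.
have [g fK gK] := linaut_bij f.
have glin : linear g.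
  by move=> a x y; apply: (can_inj fK); rewrite (linaut_linear f) !gK.
by exists (LinAut glin (Bijective gK fK)); split.
Qed.
Definition linaut_inv (f : linaut) : linaut := sval (cid (linaut_inv_subproof f)).

Lemma linautK (f : linaut) : cancel f (linaut_inv f).
Proof. by rewrite /linaut_inv; case: cid => g []. Qed.
Lemma linautVK (f : linaut) : cancel (linaut_inv f) f.
Proof. by rewrite /linaut_inv; case: cid => g []. Qed.

Lemma linaut_mulA : associative linaut_mul.
Proof. by move=> f g h; exact: linaut_eq. Qed.
Lemma linaut_1mul : left_id linaut_one linaut_mul.
Proof. by move=> f; exact: linaut_eq. Qed.
Lemma linaut_mul1 : right_id linaut_one linaut_mul.
Proof. by move=> f; exact: linaut_eq. Qed.
Lemma linaut_Vmul : left_inverse linaut_one linaut_inv linaut_mul.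
Proof. by move=> f; apply: linaut_eq => x; exact: linautK. Qed.
Lemma linaut_mulV : right_inverse linaut_one linaut_inv linaut_mul.
Proof. by move=> f; apply: linaut_eq => x; exact: linautVK. Qed.

HB.instance Definition _ := isGroup.Build linaut
  linaut_mulA linaut_1mul linaut_mul1 linaut_Vmul linaut_mulV.

Lemma linautME (f g : linaut) x : (f * g)%g x = f (g x).
Proof. by []. Qed.
Lemma linaut1E x : (1%g : linaut) x = x.
Proof. by []. Qed.
Lemma linautVE (f : linaut) : (f^-1)%g = linaut_inv f.
Proof. by []. Qed.

End LinearAut.

Section ProductGroup.
Variables (I : Type) (G : I -> groupType).

Definition prod_group := forall i, G i.
HB.instance Definition _ := gen_eqMixin prod_group.
HB.instance Definition _ := gen_choiceMixin prod_group.

Definition prod_group_one : prod_group := fun i => 1%g.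
Definition prod_group_mul (f g : prod_group) : prod_group :=
  fun i => (f i * g i)%g.
Definition prod_group_inv (f : prod_group) : prod_group := fun i => (f i)^-1%g.

Lemma prod_group_mulA : associative prod_group_mul.
Proof. by move=> f g h; apply: functional_extensionality_dep => i; exact: mulgA. Qed.
Lemma prod_group_1mul : left_id prod_group_one prod_group_mul.
Proof. by move=> f; apply: functional_extensionality_dep => i; exact: mul1g. Qed.
Lemma prod_group_mul1 : right_id prod_group_one prod_group_mul.
Proof. by move=> f; apply: functional_extensionality_dep => i; exact: mulg1. Qed.
Lemma prod_group_Vmul : left_inverse prod_group_one prod_group_inv prod_group_mul.
Proof. by move=> f; apply: functional_extensionality_dep => i; exact: mulVg. Qed.
Lemma prod_group_mulV : right_inverse prod_group_one prod_group_inv prod_group_mul.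
Proof. by move=> f; apply: functional_extensionality_dep => i; exact: mulgV. Qed.

HB.instance Definition _ := isGroup.Build prod_group prod_group_mulA
  prod_group_1mul prod_group_mul1 prod_group_Vmul prod_group_mulV.

End ProductGroup.

Definition is_subgroup (G : groupType) (H : set G) : Prop :=
  [/\ H 1%g, forall x y, H x -> H y -> H (x * y)%g
    & forall x, H x -> H (x^-1)%g].

(* [K = N ><| H], internally, for subgroups of an ambient group. *)
Definition internal_sdprod (G : groupType) (K N H : set G) : Prop :=
  [/\ [/\ is_subgroup K, is_subgroup N & is_subgroup H],
      N `<=` K /\ H `<=` K,
      (forall k n, K k -> N n -> N (k * n * k^-1)%g),
      N `&` H = [set 1%g]
    & forall k, K k -> exists n h, [/\ N n, H h & k = (n * h)%g]].

Section Submodule.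
Variables (R : pzRingType) (V : lmodType R) (P : submodClosed V).

Definition submod := {x : V | x \in P}.
HB.instance Definition _ := SubChoice.on submod.
HB.instance Definition _ := [SubChoice_isSubLmodule of submod by <:].

Variables (f : linaut V) (fP : forall x, (f x \in P) = (x \in P)).

Definition restr_fun (x : submod) : submod :=
  exist _ (f (val x)) (etrans (fP (val x)) (valP x)).

Lemma restr_linear : linear restr_fun.
Proof. by move=> a x y; apply: val_inj; rewrite /= linearP. Qed.

Lemma restr_bij : bijective restr_fun.
Proof.
have fPV x : (linaut_inv f x \in P) = (x \in P) by rewrite -fP linautVK.
exists (fun x : submod => exist _ _ (etrans (fPV (val x)) (valP x)) : submod).
  by move=> x; apply: val_inj; rewrite /= linautK.
by move=> x; apply: val_inj; rewrite /= linautVK.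
Qed.

Definition restr_linaut : linaut submod := LinAut restr_linear restr_bij.

End Submodule.

Section QuotientModule.
Local Open Scope quotient_scope.
Variables (R : pzRingType) (V : lmodType R) (P : submodClosed V).

(* A [submodClosed] predicate is not canonically a [zmodClosed] one. *)
Definition submod_pred : {pred V} := fun x => x \in P.
HB.instance Definition _ := GRing.isSubmodClosed.Build R V submod_pred
  (GRing.subsemimodClosedP P).

Definition quotmod := Quotient.quot submod_pred.
HB.instance Definition _ := ZmodQuotient.on quotmod.
Local Notation Q := quotmod.

Definition quot_scale (a : R) := lift_op1 Q ( *:%R a).

Lemma pi_quot_scale a : {morph \pi_Q : x / a *: x >-> quot_scale a x}.
Proof.
move=> x; unlock quot_scale; apply/eqP; rewrite -Quotient.idealrBE -scalerBr.
by rewrite rpredZ // Quotient.idealrBE reprK.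
Qed.

Lemma quot_scalerA a b v : quot_scale a (quot_scale b v) = quot_scale (a * b) v.
Proof. by rewrite -[v]reprK -!pi_quot_scale scalerA. Qed.
Lemma quot_scale1r : left_id 1 quot_scale.
Proof. by move=> v; rewrite -[v]reprK -!pi_quot_scale scale1r. Qed.
Lemma quot_scalerDr : right_distributive quot_scale +%R.
Proof.
move=> a u v; rewrite -[u]reprK -[v]reprK -raddfD -!pi_quot_scale.
by rewrite scalerDr raddfD.
Qed.
Lemma quot_scalerDl v : {morph quot_scale^~ v : a b / a + b}.
Proof. by move=> a b; rewrite -[v]reprK -!pi_quot_scale scalerDl raddfD. Qed.

HB.instance Definition _ := GRing.Zmodule_isLmodule.Build R Q
  quot_scalerA quot_scale1r quot_scalerDr quot_scalerDl.

Lemma quot_piZ a (x : V) : \pi_Q (a *: x) = a *: \pi_Q x.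
Proof. exact: pi_quot_scale. Qed.

Lemma quot_piD (x y : V) : \pi_Q (x + y) = \pi_Q x + \pi_Q y.
Proof. exact: raddfD. Qed.

Lemma quot_piP (x y : V) : reflect (\pi_Q x = \pi_Q y) (x - y \in P).
Proof. by rewrite -[_ \in P]/(_ \in submod_pred) Quotient.idealrBE; exact: eqP. Qed.

Variables (f : linaut V) (fP : forall x, (f x \in P) = (x \in P)).

Lemma quot_linautP x y : (f x - f y \in P) = (x - y \in P).
Proof. by rewrite -[in RHS]fP (raddfB f). Qed.

Definition quot_fun : Q -> Q := lift_op1 Q f.

Lemma quot_funE x : quot_fun (\pi_Q x) = \pi_Q (f x).
Proof.
rewrite /quot_fun; unlock; apply/quot_piP; rewrite quot_linautP.
by apply/quot_piP; rewrite reprK.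
Qed.

Lemma quot_linear : linear quot_fun.
Proof.
move=> a x y; rewrite -[x]reprK -[y]reprK -quot_piZ -quot_piD !quot_funE.
by rewrite (linaut_linear f) quot_piD quot_piZ.
Qed.

Lemma quot_bij : bijective quot_fun.
Proof.
have [g fK gK] := linaut_bij f.
exists (fun x : Q => \pi_Q (g (repr x))) => x.
  rewrite -[x in RHS]reprK -[x in LHS]reprK quot_funE.
  apply/quot_piP; rewrite -quot_linautP gK.
  by apply/quot_piP; rewrite reprK.
by rewrite quot_funE gK reprK.
Qed.

Definition quot_linaut : linaut Q := LinAut quot_linear quot_bij.

End QuotientModule.

Section FiniteSubsets.
Variable X : choiceType.

Definition fsubsets := {fset X}.
HB.instance Definition _ := Choice.on fsubsets.

Implicit Types A B D : fsubsets.

Definition fs_add A B : fsubsets := ((A `\` B) `|` (B `\` A))%fset.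
Definition fs_zero : fsubsets := fset0.
Definition fs_scale (a : 'F_2) A : fsubsets := if a == 0 then fset0 else A.

Lemma in_fs_add A B x : (x \in fs_add A B) = (x \in A) (+) (x \in B).
Proof. by rewrite !inE; case: (x \in A); case: (x \in B). Qed.

Lemma fs_addA : associative fs_add.
Proof. by move=> A B D; apply/fsetP => x; rewrite !in_fs_add addbA. Qed.
Lemma fs_addC : commutative fs_add.
Proof. by move=> A B; apply/fsetP => x; rewrite !in_fs_add addbC. Qed.
Lemma fs_add0 : left_id fs_zero fs_add.
Proof. by move=> A; apply/fsetP => x; rewrite in_fs_add inE. Qed.
Lemma fs_addN : left_inverse fs_zero id fs_add.
Proof. by move=> A; apply/fsetP => x; rewrite in_fs_add addbb inE. Qed.

HB.instance Definition _ :=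
  GRing.isZmodule.Build fsubsets fs_addA fs_addC fs_add0 fs_addN.

Lemma F2_cases (a : 'F_2) : a = 0 \/ a = 1.
Proof. by case: a => [[|[|]]] // ?; [left | right]; exact: val_inj. Qed.

Lemma fs_scalerA a b A : fs_scale a (fs_scale b A) = fs_scale (a * b) A.
Proof.
by rewrite /fs_scale; case: (F2_cases a) => ->; case: (F2_cases b) => ->.
Qed.
Lemma fs_scale1r : left_id 1 fs_scale. Proof. by []. Qed.
Lemma fs_scalerDr : right_distributive fs_scale +%R.
Proof.
move=> a A B; rewrite /fs_scale; case: ifP => // _; apply/fsetP => x.
by rewrite in_fs_add inE.
Qed.
Lemma fs_scalerDl A : {morph fs_scale^~ A : a b / a + b}.
Proof.
move=> a b; apply/fsetP => x; rewrite in_fs_add /fs_scale.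
case: (F2_cases a) => ->; case: (F2_cases b) => -> /=; rewrite ?inE //.
- by rewrite addbF.
- by rewrite addbb.
Qed.

HB.instance Definition _ := GRing.Zmodule_isLmodule.Build 'F_2 fsubsets
  fs_scalerA fs_scale1r fs_scalerDr fs_scalerDl.

(* The subspace [[T]] of [[X]], as a boolean predicate. *)
Definition fs_in (T : set X) : {pred fsubsets} :=
  fun A => `[< forall x, x \in A -> T x >].

Lemma fs_inP T A : reflect (forall x, x \in A -> T x) (A \in fs_in T).
Proof. exact: asboolP. Qed.

Lemma fs_in_closed T : submod_closed (fs_in T).
Proof.
split=> [|a A B /fs_inP AT /fs_inP BT]; apply/fs_inP => x; first by rewrite inE.
rewrite in_fs_add; case: (F2_cases a) => ->; first by rewrite inE; exact: BT.
have [xA _|/negPf xA] := boolP (x \in A); first exact: AT.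
exact: BT.
Qed.

HB.instance Definition _ T :=
  GRing.isSubmodClosed.Build 'F_2 fsubsets (fs_in T) (fs_in_closed T).

End FiniteSubsets.

Section RightAngled.
Variables (W : groupType) (S : set W).

Local Notation FS := (fsubsets S).

Definition centr (X : set S) : set S :=
  [set y | forall x, X x -> commute (val x) (val y)].

(* [C^2(s)]; [centr] is the operator [C]. *)
Definition cell_of (s : S) : set S := centr (centr [set s]).

Definition cells : set (set S) := range cell_of.

Definition kernel_of (s : S) : set S := [set t | cell_of t = cell_of s].

Definition kernels : set (set S) := range kernel_of.

Definition star (T : set S) : set S := [set x | cell_of x `<` T].

Definition fspan (T : set S) : set FS := [set A | A \in fs_in T].

Definition commuting_fsubsets : set FS :=
  [set A | forall x y, x \in A -> y \in A -> commute (val x) (val y)].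

Definition AutSc : set (linaut FS) :=
  [set phi | phi @` commuting_fsubsets = commuting_fsubsets].

Definition Kgroup : set (linaut FS) :=
  [set phi | AutSc phi /\ forall T, cells T -> phi @` fspan T = fspan T].

Definition Dgroup : set (linaut FS) :=
  [set phi | forall N, kernels N -> phi @` fspan N = fspan N].

Lemma image_linaut1 (E : set FS) : (1%g : linaut FS) @` E = E.
Proof. by rewrite -[RHS]image_id. Qed.

Lemma image_linautM (f g : linaut FS) (E : set FS) :
  f @` E = E -> g @` E = E -> (f * g)%g @` E = E.
Proof. by move=> fE gE; rewrite -[in RHS]fE -[in RHS]gE image_comp. Qed.

Lemma image_linautV (f : linaut FS) (E : set FS) :
  f @` E = E -> (f^-1)%g @` E = E.
Proof.
move=> fE; rewrite -[in LHS]fE image_comp -[RHS]image_id.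
by apply: eq_imagel => x _ /=; rewrite linautVE linautK.
Qed.

Lemma image_linautP (f : linaut FS) (T : set S) :
  f @` fspan T = fspan T -> forall A, (f A \in fs_in T) = (A \in fs_in T).
Proof.
move=> fT A; apply/idP/idP => [fA|AT].
  have : (f @` fspan T) (f A) by rewrite fT.
  by move=> [B BT /(bij_inj (linaut_bij f)) <-].
suff: fspan T (f A) by [].
by rewrite -fT; exists A.
Qed.

Definition Kpred : {pred linaut FS} := fun phi => phi \in Kgroup.

Lemma Kpred_closed : group_closed Kpred.
Proof.
split; first by apply/mem_set; split=> [|T _]; exact: image_linaut1.
move=> f g /set_mem[fc fT] /set_mem[gc gT]; apply/mem_set; split=> [|T cT].
  by apply: image_linautM => //; exact: image_linautV.
by apply: image_linautM; [exact: fT | apply: image_linautV; exact: gT].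
Qed.

Definition Ktype := {phi : linaut FS | phi \in Kpred}.
HB.instance Definition _ := SubChoice.on Ktype.
HB.instance Definition _ :=
  SubChoice_isSubGroup.Build (linaut FS) Kpred Ktype Kpred_closed.

Lemma cell_refl (s : S) : cell_of s s.
Proof. by move=> x sx; apply/commute_sym/sx. Qed.

Lemma centr_sub (X Y : set S) : X `<=` Y -> centr Y `<=` centr X.
Proof. by move=> XY y Yy x /XY; exact: Yy. Qed.

Lemma centr2 (X : set S) : X `<=` centr (centr X).
Proof. by move=> x Xx y Xy; apply/commute_sym/Xy. Qed.

Lemma cell_sub (s t : S) : cell_of s t -> cell_of t `<=` cell_of s.
Proof.
move=> st; apply: (@subset_trans _ (centr (centr (cell_of s)))).
  by do 2 apply: centr_sub; move=> _ ->.
by apply: centr_sub; exact: centr2.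
Qed.

Lemma K_star_sub (phi : linaut FS) (T : set S) :
  Kgroup phi -> phi @` fspan (star T) `<=` fspan (star T).
Proof.
move=> [_ phiT] _ [A /= + <-]; rewrite /fspan /=.
elim/fset1U_rect: A => [|x A xA IH] AT; first by rewrite raddf0 rpred0.
have -> : (x |` A)%fset = ([fset x]%fset : FS) + A.
  apply/fsetP => y; rewrite [RHS]in_fs_add !inE.
  by case: eqVneq => [->|//]; rewrite (negPf xA).
have xT : star T x by move/fs_inP: AT; apply; rewrite !inE eqxx.
rewrite raddfD rpredD //.
  apply/fs_inP => y; suff: fspan (cell_of x) (phi ([fset x]%fset : FS)).
    move=> /fs_inP/[apply] xy.
    have [xT1 xT2] := xT; split; first exact: subset_trans (cell_sub xy) xT1.
    by move=> Ty; apply: xT2; apply: subset_trans Ty (cell_sub xy).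
  rewrite -phiT; last by exists x.
  exists [fset x]%fset => //; apply/fs_inP => z.
  by rewrite inE => /eqP ->; exact: cell_refl.
apply: IH; apply/fs_inP => y yA; move/fs_inP: AT; apply.
by rewrite !inE yA orbT.
Qed.

Lemma K_star (phi : linaut FS) (T : set S) :
  Kgroup phi -> phi @` fspan (star T) = fspan (star T).
Proof.
move=> Kphi; apply/seteqP; split; first exact: K_star_sub.
have KV : Kgroup (phi^-1)%g.
  by case: Kphi => pc pT; split=> [|U cU]; apply: image_linautV; [|exact: pT].
move=> A AT; exists ((phi^-1)%g A); last by rewrite linautVE linautVK.
by apply: (K_star_sub KV); exists A.
Qed.

Definition star_in (T : set S) : {pred submod (fs_in T)} :=
  fun A => val A \in fs_in (star T).

Lemma star_in_closed T : submod_closed (@star_in T).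
Proof.
split=> [|a A B AT BT]; first exact: rpred0.
by rewrite -topredE /= /star_in /= rpredD // rpredZ.
Qed.

HB.instance Definition _ T := GRing.isSubmodClosed.Build 'F_2
  (submod (fs_in T)) (@star_in T) (@star_in_closed T).

Definition cell_space (T : set S) := quotmod (@star_in T).
HB.instance Definition _ T := GRing.Lmodule.on (cell_space T).

Section Rho3.
Variables (phi : Ktype) (T : cells).

Lemma Ktype_in : Kgroup (val phi).
Proof. exact/set_mem/(valP phi). Qed.

Lemma Ktype_cell (A : FS) : (val phi A \in fs_in (val T)) = (A \in fs_in (val T)).
Proof.
by apply: image_linautP; have [_] := Ktype_in; apply; exact/set_mem/(valP T).
Qed.

Lemma Ktype_star (A : submod (fs_in (val T))) :
  (restr_linaut Ktype_cell A \in @star_in (val T)) = (A \in @star_in (val T)).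
Proof. exact: (image_linautP (K_star (val T) Ktype_in)). Qed.

Definition rho3_comp : linaut (cell_space (val T)) := quot_linaut Ktype_star.

End Rho3.

Definition cell_auts := prod_group (fun T : cells => linaut (cell_space (val T))).
HB.instance Definition _ := Group.on cell_auts.

Definition rho3 (phi : Ktype) : cell_auts := fun T => rho3_comp phi T.

Lemma rho3E (phi : Ktype) (T : cells) (A : submod (fs_in (val T))) :
  rho3 phi T (\pi_(cell_space (val T))%qT A) =
  \pi_(cell_space (val T))%qT (restr_linaut (Ktype_cell phi T) A).
Proof. exact: quot_funE (@Ktype_star phi T) A. Qed.

Lemma rho3M : {morph rho3 : phi psi / (phi * psi)%g}.
Proof.
move=> phi psi; apply: functional_extensionality_dep => T; apply: linaut_eq => x.
rewrite -[x]reprK linautME !rho3E; congr \pi_(_)%qT.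
exact: val_inj.
Qed.

HB.instance Definition _ := isMultiplicative.Build Ktype cell_auts rho3 rho3M.

(* The kernel of [rho3], viewed as a subgroup of [Aut([S])]. *)
Definition Kcirc : set (linaut FS) := val @` [set phi : Ktype | rho3 phi = 1%g].

End RightAngled.

Arguments Kgroup {W} S.
Arguments Kcirc {W} S.
Arguments Dgroup {W} S.
Arguments Ktype {W} S.
Arguments rho3 {W} S.

(* Main.v *)
Require Import Defs.
From HB Require Import structures.
From mathcomp Require Import all_boot all_algebra finmap all_classical.

Local Open Scope classical_set_scope.

(** A cell [T] is the disjoint union of its kernel [N] and of [star T], so
    [[N]] is a complement of [[star T]] in [[T]] and projects isomorphically
    onto [V_T].  As [[S]] is the direct sum of the [[N]]'s, an automorphism in
    [Dgroup] is the same thing as a family of automorphisms of the [[N]]'s,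
    that is, of the [V_T]'s.  Such automorphisms
    preserve commuting subsets because whether [s] and [t] commute depends only
    on their kernels. *)

(** * Finite subsets as a vector space with the singletons as basis *)

Section FiniteSubsetsTheory.
Set Implicit Arguments.
Unset Strict Implicit.
Unset Printing Implicit Defensive.
Import GRing.Theory.
Local Open Scope ring_scope.
Variable X : choiceType.
Local Notation FS := (fsubsets X).

Definition fs1 (x : X) : FS := [fset x]%fset.

Lemma in_fs1 (x y : X) : (y \in fs1 x) = (y == x).
Proof. by rewrite inE. Qed.

Lemma in_addfs (A B : FS) x : (x \in A + B) = (x \in A) (+) (x \in B).
Proof. exact: in_fs_add. Qed.

Lemma fs_addvv (A : FS) : A + A = 0.
Proof. exact: fs_addN. Qed.

Lemma fs1_in (N : set X) x : N x -> fs1 x \in fs_in N.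
Proof. by move=> Nx; apply/fs_inP => y; rewrite in_fs1 => /eqP ->. Qed.

Lemma fset1UD (x : X) (A : {fset X}) : x \notin A ->
  (x |` A)%fset = fs1 x + A :> FS.
Proof.
move=> xA; apply/fsetP => y; rewrite in_addfs !inE.
by case: eqVneq => [->|//]; rewrite (negPf xA).
Qed.

(** Keeping [x \in A] in the induction step lets two additive maps be compared at [A] from the
    elements of [A] alone. *)
Lemma fs_ind_in (P : FS -> Prop) (A : FS) : P 0 ->
  (forall x B, x \in A -> P B -> P (fs1 x + B)) -> P A.
Proof.
move=> P0 PD; suff: forall B : FS, {subset B <= A} -> P B by apply.
elim/fset1U_rect => [//|x B xB IH] BA.
rewrite fset1UD //; apply: PD; first by apply: BA; rewrite !inE eqxx.
by apply: IH => y yB; apply: BA; rewrite !inE yB orbT.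
Qed.

Lemma fs_additive0 (V : zmodType) (f : FS -> V) :
  {morph f : A B / A + B} -> f 0 = 0.
Proof. by move=> fD; apply: (@addrI _ (f 0)); rewrite -fD !addr0. Qed.

Lemma fs_additive_eq (V : zmodType) (f g : FS -> V) (A : FS) :
  {morph f : A B / A + B} -> {morph g : A B / A + B} ->
  (forall x, x \in A -> f (fs1 x) = g (fs1 x)) -> f A = g A.
Proof.
move=> fD gD fg; apply: (@fs_ind_in (fun B => f B = g B)) => [|x B xA IH].
  by rewrite !fs_additive0.
by rewrite fD gD fg // IH.
Qed.

(** The only scalars are 0 and 1. *)
Lemma fs_additive_linear (f : FS -> FS) :
  {morph f : A B / A + B} -> linear f.
Proof.
move=> fD a A B; rewrite fD; case: (F2_cases a) => ->.
  by rewrite !scale0r (@fs_additive0 _ f).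
by rewrite !scale1r.
Qed.

(** The linear map with prescribed values on the basis of singletons. *)
Definition fs_extend (f : X -> FS) (A : FS) : FS := \sum_(x <- A) f x.

Lemma fs_extend1 f x : fs_extend f (fs1 x) = f x.
Proof. by rewrite /fs_extend big_seq_fset1. Qed.

Lemma fs_extendD f : {morph fs_extend f : A B / A + B}.
Proof.
have addx x A : fs_extend f (fs1 x + A) = f x + fs_extend f A.
  have [xA|xA] := boolP (x \in A); last first.
    by rewrite -fset1UD // /fs_extend big_fsetU1.
  (* Adding an [x] that is already in [A] removes it, and the two copies of [f x] cancel in
     characteristic two. *)
  rewrite {2}/fs_extend (big_fsetD1 _ xA) addrA fs_addvv add0r.
  apply: eq_fbigl => y; rewrite in_addfs in_fs1 !inE.
  by case: eqVneq => [->|//]; rewrite xA.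
move=> A B; elim/fset1U_rect: A => [|x A xA IH].
  by rewrite add0r /fs_extend big_seq_fset0 add0r.
by rewrite fset1UD // -addrA !addx IH addrA.
Qed.

End FiniteSubsetsTheory.

Section Cells.
Set Implicit Arguments.
Unset Strict Implicit.
Unset Printing Implicit Defensive.
Import GRing.Theory.
Local Open Scope ring_scope.
Local Open Scope quotient_scope.
Variables (W : groupType) (S : set W).
Local Notation FS := (fsubsets S).

(** * Commutation depends only on kernels *)

Lemma centr_cell (s : S) : centr (cell_of s) = centr [set s].
Proof. by apply/seteqP; split; [exact/centr_sub/centr2|exact: centr2]. Qed.

(** Since $C^3=C$, equal cells give equal centralizers, so [s] and then [t] can be replaced. *)
Lemma kernel_commute (s s' t t' : S) : cell_of s' = cell_of s ->
  cell_of t' = cell_of t -> commute (val s) (val t) -> commute (val s') (val t').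
Proof.
have centr_eq (x y : S) : cell_of x = cell_of y -> centr [set x] = centr [set y].
  by rewrite -!centr_cell => ->.
move=> /centr_eq ss /centr_eq tt st.
have ts' : centr [set t] s'.
  have : centr [set s'] t by rewrite ss => _ ->.
  by move=> /(_ s' erefl) s't _ ->; exact: commute_sym.
by move: ts'; rewrite -tt => /(_ t' erefl) ?; exact: commute_sym.
Qed.

Definition mkcell (s : S) : @cells W S :=
  exist _ (cell_of s) (mem_set (imageP (@cell_of W S) (I : setT s))).

Lemma cellP (T : @cells W S) : exists s, T = mkcell s.
Proof. by case: (set_mem (valP T)) => s _ sT; exists s; exact: val_inj. Qed.

(** * The kernel part of a cell as a model of its quotient space *)

(** For a cell $T$ with kernel $N$, this is the projection of $[S]$ onto $[N]$ along the other
    kernels; testing the cell of [x] avoids choosing a representative of $N$. *)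
Definition cut_set (T : set S) (A : FS) : FS :=
  [fset x in A | `[< cell_of x = T >]]%fset.

Lemma in_cut (T : set S) (A : FS) x :
  (x \in cut_set T A) = (x \in A) && `[< cell_of x = T >].
Proof. by rewrite !inE. Qed.

Lemma cut_in (T : set S) A : cut_set T A \in fs_in T.
Proof.
apply/fs_inP => x; rewrite in_cut => /andP[_ /asboolP <-]; exact: cell_refl.
Qed.

Definition cut (T : set S) (A : FS) : submod (fs_in T) :=
  exist _ (cut_set T A) (cut_in T A).

Lemma cutD T : {morph cut T : A B / A + B}.
Proof.
move=> A B; apply: val_inj; apply/fsetP => x.
rewrite raddfD /= in_addfs !in_cut in_addfs.
by case: `[< _ >]; rewrite ?andbT ?andbF.
Qed.

Lemma cut_kernel s A : A \in fs_in (kernel_of s) -> cut_set (cell_of s) A = A.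
Proof.
move=> /fs_inP AN; apply/fsetP => x; rewrite in_cut.
by case: (boolP (x \in A)) => // /AN xN; rewrite asboolT.
Qed.

Lemma cut_set_kernel s A : cut_set (cell_of s) A \in fs_in (kernel_of s).
Proof. by apply/fs_inP => x; rewrite in_cut => /andP[_ /asboolP]. Qed.

(** Cutting first makes the map total on $[S]$, with no proof that [A] lies in $[T]$. *)
Definition proj (T : @cells W S) (A : FS) : cell_space (val T) :=
  \pi_(cell_space (val T)) (cut (val T) A).

(** The inverse of the isomorphism $[N]\to V_T$: representatives of [v] differ by an element of
    $[T^\star]$, which the cut kills. *)
Definition lift (T : @cells W S) (v : cell_space (val T)) : FS :=
  cut_set (val T) (val (repr v)).

Lemma pi_cut (T : @cells W S) (A : submod (fs_in (val T))) :
  \pi_(cell_space (val T)) A = proj T (val A).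
Proof.
apply/quot_piP; apply/fs_inP => x.
have -> : val (A - cut (val T) (val A)) = val A + cut_set (val T) (val A) by [].
rewrite in_addfs in_cut; have [xA|//] := boolP (x \in _).
(* What the cut discards is an [x] in $T$ with cell other than $T$; that cell is contained in $T$,
   hence properly, so [x] is in $T^\star$. *)
case: asboolP => //= xT _; have [s Ts] := cellP T.
have /fs_inP/(_ _ xA) := valP A; rewrite {}Ts /= in xT * => /cell_sub sx.
by rewrite /star /= properEneq; split=> //; apply/eqP.
Qed.

Lemma projD T : {morph proj T : A B / A + B}.
Proof. by move=> A B; rewrite /proj cutD quot_piD. Qed.

Lemma proj_lift T : cancel (@lift T) (proj T).
Proof.
move=> v; rewrite -[RHS]reprK pi_cut /proj; congr (\pi_(_) _); apply: val_inj.
by apply/fsetP => x /=; rewrite !in_cut; case: `[< _ >]; rewrite ?andbT ?andbF.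
Qed.

Lemma lift_proj T A : lift (proj T A) = cut_set (val T) A.
Proof.
apply/fsetP => x; rewrite !in_cut.
have /quot_piP/fs_inP/(_ x) := reprK (proj T A).
have -> : val (repr (proj T A) - cut (val T) A) =
  val (repr (proj T A)) + cut_set (val T) A by [].
rewrite in_addfs in_cut; case: asboolP => [xT|_ _]; rewrite ?andbF ?andbT //.
(* A disagreement at [x] would put it in $T^\star$, making $T$ a proper subset of itself. *)
by case: (x \in A); case: (x \in _) => // /(_ isT) []; rewrite xT => _ [].
Qed.

(** [repr] need not be additive, but [lift] inherits additivity from the cut through [proj]. *)
Lemma liftD T : {morph @lift T : u v / u + v}.
Proof.
move=> u v; rewrite -[u]proj_lift -[v]proj_lift -projD !lift_proj.
exact: (congr1 val (cutD _ _ _)).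
Qed.

Lemma lift_kernel s (v : cell_space (val (mkcell s))) :
  lift v \in fs_in (kernel_of s).
Proof. exact: cut_set_kernel. Qed.

Lemma proj_inj_kernel s A B : A \in fs_in (kernel_of s) ->
  B \in fs_in (kernel_of s) -> proj (mkcell s) A = proj (mkcell s) B -> A = B.
Proof.
by move=> AN BN /(congr1 (@lift _)); rewrite !lift_proj !cut_kernel.
Qed.

(** * Gluing automorphisms of the quotient spaces *)

(** The component [a T] transported to $[N]$ and extended by zero on the other kernels. *)
Definition on_cell (a : cell_auts S) (T : @cells W S) (A : FS) : FS :=
  lift (a T (proj T A)).

Lemma on_cellD a T : {morph on_cell a T : A B / A + B}.
Proof. by move=> A B; rewrite /on_cell projD raddfD liftD. Qed.

Definition extend_auts (a : cell_auts S) : FS -> FS :=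
  fs_extend (fun x => on_cell a (mkcell x) (fs1 x)).

Lemma extend_autsD a : {morph extend_auts a : A B / A + B}.
Proof. exact: fs_extendD. Qed.

Lemma extend_auts_kernel a s A : A \in fs_in (kernel_of s) ->
  extend_auts a A = on_cell a (mkcell s) A.
Proof.
move=> /fs_inP AN.
apply: fs_additive_eq => [||x xA]; [exact: extend_autsD|exact: on_cellD|].
rewrite /extend_auts fs_extend1; congr on_cell.
by apply: val_inj => /=; exact: AN.
Qed.

Lemma extend_auts_in_kernel a s A : A \in fs_in (kernel_of s) ->
  extend_auts a A \in fs_in (kernel_of s).
Proof. by move=> AN; rewrite (extend_auts_kernel _ AN) lift_kernel. Qed.

Lemma fs1_kernel (x : S) : fs1 x \in fs_in (kernel_of x).
Proof. exact: fs1_in. Qed.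

(** The inner map keeps each singleton inside its own kernel, where both maps are transported
    components; this also yields inverses. *)
Lemma extend_autsM a b A :
  extend_auts a (extend_auts b A) = extend_auts (a * b)%g A.
Proof.
apply: (@fs_additive_eq _ _ (extend_auts a \o extend_auts b)) => [B D|B D|x _] /=.
- by rewrite !extend_autsD.
- by rewrite extend_autsD.
have xN := fs1_kernel x.
rewrite (extend_auts_kernel _ (extend_auts_in_kernel b xN)).
by rewrite !(extend_auts_kernel _ xN) /on_cell proj_lift.
Qed.

Lemma extend_auts1 A : extend_auts 1%g A = A.
Proof.
apply: (@fs_additive_eq _ _ _ id) => [B D|//|x _]; first exact: extend_autsD.
rewrite (extend_auts_kernel _ (fs1_kernel x)) /on_cell linaut1E lift_proj.
exact/cut_kernel/fs1_kernel.
Qed.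

Lemma extend_autsK a : cancel (extend_auts a) (extend_auts a^-1%g).
Proof. by move=> A; rewrite extend_autsM mulVg extend_auts1. Qed.

Lemma extend_autsVK a : cancel (extend_auts a^-1%g) (extend_auts a).
Proof. by move=> A; rewrite extend_autsM mulgV extend_auts1. Qed.

Definition extend_linaut (a : cell_auts S) : linaut FS :=
  LinAut (fs_additive_linear (@extend_autsD a))
    (Bijective (extend_autsK a) (extend_autsVK a)).

Lemma extend_linaut_D a : Dgroup S (extend_linaut a).
Proof.
move=> _ [s _ <-]; apply/seteqP; split => [_ [A AN <-]|A AN].
  exact: extend_auts_in_kernel.
exists (extend_auts a^-1%g A); last exact: extend_autsVK.
exact: extend_auts_in_kernel.
Qed.

(** * Inclusion of $D(\Gamma)$ in $K(\Gamma)$ *)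

Lemma D_subgroup : is_subgroup (Dgroup S).
Proof.
split=> [N _|f g fD gD N cN|f fD N cN]; first exact: image_linaut1.
  by apply: image_linautM; [exact: fD|exact: gD].
by apply: image_linautV; exact: fD.
Qed.

Lemma D_in_kernel (phi : linaut FS) s A : Dgroup S phi ->
  A \in fs_in (kernel_of s) -> phi A \in fs_in (kernel_of s).
Proof.
by move=> phiD; rewrite (image_linautP (phiD (kernel_of s) _)) //; exists s.
Qed.

Lemma D_support (phi : linaut FS) A y : Dgroup S phi -> y \in phi A ->
  exists2 x, x \in A & cell_of y = cell_of x.
Proof.
move=> phiD.
pose P (B : FS) := y \in phi B -> exists2 x, x \in A & cell_of y = cell_of x.
apply: (@fs_ind_in _ P) => [|x B xA IH]; rewrite /P.
  by rewrite raddf0 inE.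
rewrite raddfD in_addfs; have [yB _|_] := boolP (y \in phi B); first exact: IH.
rewrite addbF => yx; exists x => //.
by have /fs_inP/(_ _ yx) := D_in_kernel phiD (fs1_kernel x).
Qed.

(** Stability under the inverse turns the inclusion into an equality. *)
Lemma image_linaut_eq (G : set (linaut FS)) (E : set FS) : is_subgroup G ->
  (forall phi A, G phi -> E A -> E (phi A)) ->
  forall phi, G phi -> phi @` E = E.
Proof.
move=> [_ _ GV] GE phi Gphi; apply/seteqP; split => [_ [A EA <-]|A EA].
  exact: GE.
exists (phi^-1%g A); first by apply: GE => //; exact: GV.
by rewrite linautVE linautVK.
Qed.

Lemma D_sub_K : Dgroup S `<=` Kgroup S.
Proof.
move=> phi phiD; split; [|move=> _ [s _ <-]];
  apply: (image_linaut_eq D_subgroup) phiD => {}phi A phiD.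
  (* Elements of the image share kernels with elements of [A], which commute. *)
  move=> Ac x y /(D_support phiD)[x' /Ac xx' ex] /(D_support phiD)[y' /xx' xy ey].
  exact: kernel_commute xy.
(* Cells are unions of kernels. *)
move=> /fs_inP As; apply/fs_inP => x /(D_support phiD)[y /As/cell_sub ys xy].
by apply: ys; rewrite -xy; exact: cell_refl.
Qed.

Lemma K_subgroup : is_subgroup (Kgroup S).
Proof.
split=> [|f g [fA fT] [gA gT]|f [fA fT]].
- by split=> [|T _]; exact: image_linaut1.
- split=> [|T cT]; first exact: image_linautM.
  by apply: image_linautM; [exact: fT|exact: gT].
- by split=> [|T cT]; apply: image_linautV => //; exact: fT.
Qed.

(** * Bijectivity of $\rho_3$ on $D(\Gamma)$ *)

Lemma rho3_proj (phi : Ktype S) s A : Dgroup S (val phi) ->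
  A \in fs_in (kernel_of s) ->
  rho3 S phi (mkcell s) (proj (mkcell s) A) = proj (mkcell s) (val phi A).
Proof.
by move=> phiD AN; rewrite rho3E pi_cut /= cut_kernel.
Qed.

(** Singletons span $[S]$, and each stays in one $[N]$, where [proj] is injective. *)
Lemma rho3_inj_D (phi psi : Ktype S) : Dgroup S (val phi) ->
  Dgroup S (val psi) -> rho3 S phi = rho3 S psi -> phi = psi.
Proof.
move=> phiD psiD eq_rho; apply: val_inj; apply: linaut_eq => A.
apply: fs_additive_eq => [B D|B D|x _]; [exact: raddfD|exact: raddfD|].
have xN := fs1_kernel x.
apply: (@proj_inj_kernel x); [exact: D_in_kernel|exact: D_in_kernel|].
by rewrite -!rho3_proj // eq_rho.
Qed.

(** A section of $\rho_3$ with values in $D(\Gamma)$. *)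
Definition extend_K (a : cell_auts S) : Ktype S :=
  exist _ (extend_linaut a) (mem_set (D_sub_K (@extend_linaut_D a))).

Lemma rho3_extend_K a : rho3 S (extend_K a) = a.
Proof.
apply: functional_extensionality_dep => T; apply: linaut_eq => v.
have [s Ts] := cellP T; subst T; rewrite -[v]proj_lift.
have vN := lift_kernel v.
rewrite rho3_proj //; last exact: extend_linaut_D.
by rewrite /= (extend_auts_kernel _ vN) /on_cell proj_lift.
Qed.

Lemma rho3_bij_D :
  set_bij [set phi : Ktype S | Dgroup S (val phi)] [set: cell_auts S] (rho3 S).
Proof.
split=> [//|phi psi /set_mem phiD /set_mem psiD|a _]; first exact: rho3_inj_D.
by exists (extend_K a); [exact: extend_linaut_D|exact: rho3_extend_K].
Qed.

(** * The semidirect product decomposition *)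

Lemma rho3_1 : rho3 S 1%g = 1%g.
Proof. by apply: (@mulgI _ (rho3 S 1%g)); rewrite -rho3M !mulg1. Qed.

Lemma rho3V (phi : Ktype S) : rho3 S phi^-1%g = (rho3 S phi)^-1%g.
Proof. by apply: (@mulgI _ (rho3 S phi)); rewrite -rho3M !mulgV rho3_1. Qed.

Lemma Ktype_ofP (k : linaut FS) : Kgroup S k -> exists phi : Ktype S, val phi = k.
Proof. by move=> Kk; exists (exist _ k (mem_set Kk)). Qed.

Lemma Kcirc_sub : Kcirc S `<=` Kgroup S.
Proof. by move=> _ [phi _ <-]; exact: Ktype_in. Qed.

Lemma Kcirc_subgroup : is_subgroup (Kcirc S).
Proof.
split=> [|_ _ [f /= f1 <-] [g /= g1 <-]|_ [f /= f1 <-]].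
- by exists 1%g => //=; rewrite rho3_1.
- by exists (f * g)%g => //=; rewrite rho3M f1 g1 mulg1.
- by exists f^-1%g => //=; rewrite rho3V f1 invg1.
Qed.

Lemma K_sdprod : internal_sdprod (Kgroup S) (Kcirc S) (Dgroup S).
Proof.
split.
- by split; [exact: K_subgroup|exact: Kcirc_subgroup|exact: D_subgroup].
- by split; [exact: Kcirc_sub|exact: D_sub_K].
- move=> _ _ /Ktype_ofP[k <-] [n /= n1 <-]; exists (k * n * k^-1)%g => //=.
  by rewrite !rho3M n1 mulg1 rho3V mulgV.
- apply/seteqP; split => [_ [[n /= n1 <-] nD]|_ ->].
    (* [n] and the identity both lie in $D(\Gamma)$ and have the same image under $\rho_3$. *)
    have -> // : n = 1%g.
    by apply: rho3_inj_D => //; [case: D_subgroup|rewrite n1 rho3_1].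
  by split; [case: Kcirc_subgroup|case: D_subgroup].
(* [h] is the element of $D(\Gamma)$ with the same image as [k], so $kh^{-1}$ is in the kernel. *)
- move=> _ /Ktype_ofP[k <-]; set h := extend_K (rho3 S k).
  exists (val (k * h^-1)%g), (val h); split; last 1 first.
  + by rewrite -[k in LHS](mulgVK h).
  + exists (k * h^-1)%g => //=.
    by rewrite rho3M rho3V rho3_extend_K mulgV.
  + exact: extend_linaut_D.
Qed.

End Cells.

Theorem proposition12 (W : groupType) (S : set W) (Gamma : S -> S -> option nat)
    (WS : right_angled_coxeter_system Gamma) :
  set_bij [set phi : Ktype S | Dgroup S (val phi)] [set: cell_auts S] (rho3 S) /\
  internal_sdprod (Kgroup S) (Kcirc S) (Dgroup S).
Proof. by split; [exact: rho3_bij_D|exact: K_sdprod]. Qed.
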